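(* In the setting below: if $(S,T)$ is in the LGV position on $G$, then $(A_1,A_2)$ is a Pfaffian pair with constant $(-1)^k\operatorname{sgn}P$, where $P$ is an arbitrary disjoint $S$--$T$ path of $G$. In addition, if $G$ is equipped with a positive edge length $l:E\to\mathbb{R}_{>0}$ and $w:E^*\to\mathbb{R}$ is defined by $w(e)=l(e)$ for $e\in E$ and $w(e)=0$ for $e\in E'$, then there is a one-to-one correspondence between shortest disjoint $S$--$T$ paths of $G$ and minimum-weight common bases of $(A_1,A_2)$ with respect to $w$.
   Context: $G=(V,E)$ is an undirected graph; $S=\{s_1,\dots,s_k\}$, $T=\{t_1,\dots,t_k\}$ are disjoint vertex subsets; $\tilde V=V\setminus(S\cup T)$. A disjoint $S$--$T$ path is an edge set $P$, the union of $k$ pairwise vertex-disjoint paths $P_i$ joining $s_i$ and $t_{\sigma_P(i)}$ for a permutation $\sigma_P$; $\operatorname{sgn}P=\operatorname{sgn}\sigma_P$; its length is $\sum_{e\in P}l(e)$ and it is shortest if of minimum length. $(S,T)$ is in the LGV position if $\operatorname{sgn}P$ is constant over all disjoint $S$--$T$ paths. $G^*$ adds to $G$ a vertex $v^*$ and edges $E'=\{\{v,v^*\}:v\in\tilde V\}$; $E^*=E\cup E'$. $A$ is the incidence matrix of an arbitrary orientation of $G^*$ ($+1$ tail, $-1$ head). $A_1=A[S\cup\tilde V,E^*]$ with rows $s_1,\dots,s_k$ then $\tilde V$; $A_2=A[T\cup\tilde V,E^*]$ with rows $t_1,\dots,t_k$ then $\tilde V$ in the same order; same column order. A common base is $B\subseteq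 E^*$ with $A_1[B],A_2[B]$ square nonsingular; the pair is Pfaffian with constant $c\neq0$ if $\det A_1[B]\det A_2[B]=c$ for all common bases. The weight of $B$ is $\sum_{e\in B}w(e)$. *)

(* Defs.v *)
From HB Require Import structures.
From mathcomp Require Import all_boot all_order all_algebra all_fingroup.
From mathcomp Require Import classical_sets functions reals.

Set Implicit Arguments.
Unset Strict Implicit.
Unset Printing Implicit Defensive.

Import Order.TTheory GRing.Theory Num.Theory.
Local Open Scope ring_scope.

Section MatrixPairs.
Variables (R : realFieldType) (r n : nat).
Implicit Types (A : 'M[R]_(r, n)) (B : {set 'I_n}).

(* The columns are taken in increasing order; the product of the determinants
   of A1[B] and A2[B] does not depend on the order of B. *)
Definition col_submx A B (hB : #|B| = r) : 'M[R]_r :=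
  colsub (fun j => enum_val (cast_ord (esym hB) j)) A.

Definition common_base A1 A2 B : Prop :=
  exists hB : #|B| = r, col_submx A1 hB \in unitmx /\ col_submx A2 hB \in unitmx.

Definition Pfaffian_with A1 A2 (c : R) : Prop :=
  c != 0 /\
  forall B (hB : #|B| = r),
    col_submx A1 hB \in unitmx -> col_submx A2 hB \in unitmx ->
    \det (col_submx A1 hB) * \det (col_submx A2 hB) = c.

Definition Pfaffian_pair A1 A2 : Prop := exists c, Pfaffian_with A1 A2 c.

Definition min_common_base A1 A2 (w : 'I_n -> R) B : Prop :=
  common_base A1 A2 B /\
  forall B', common_base A1 A2 B' -> \sum_(j in B) w j <= \sum_(j in B') w j.

End MatrixPairs.

Section Graphs.
Variable V : finType.
Implicit Types (E P Q : {set {set V}}).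

Definition is_graph E : Prop := forall e, e \in E -> #|e| = 2.

(* The path with vertex sequence x :: p. *)
Definition path_edges (x : V) (p : seq V) : {set {set V}} :=
  [set e in pairmap (fun u v => [set u; v]) x p].

Section Terminals.
Variables (E : {set {set V}}) (k : nat) (s t : 'I_k -> V).

(* P is a disjoint S-T path of (V, E) with sigma_P = sigma; sigma is determined
   by P, since the P_i are the connected components of P. *)
Definition disjoint_path_perm P (sigma : 'S_k) : Prop :=
  exists p : 'I_k -> seq V,
    [/\ forall i, path (fun u v => [set u; v] \in E) (s i) (p i),
        forall i, last (s i) (p i) = t (sigma i),
        forall i, uniq (s i :: p i),
        forall i j, i != j -> [disjoint s i :: p i & s j :: p j]
      & P = \bigcup_(i < k) path_edges (s i) (p i)].

Definition disjoint_path P : Prop := exists sigma, disjoint_path_perm P sigma.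

Definition LGV_position : Prop :=
  forall P Q (sigma tau : 'S_k),
    disjoint_path_perm P sigma -> disjoint_path_perm Q tau ->
    (-1) ^+ sigma = (-1) ^+ tau :> int.

Definition shortest_disjoint_path (R : realFieldType) (l : {set V} -> R) P :
    Prop :=
  disjoint_path P /\
  forall Q, disjoint_path Q -> \sum_(e in P) l e <= \sum_(e in Q) l e.

Definition nonterminals : {set V} := [set v | v \notin codom s ++ codom t].

(* G^* has vertex type option V: v is Some v, and v^* is None. *)
Definition old_edge (e : {set V}) : {set option V} := [set Some v | v in e].
Definition new_edge (v : V) : {set option V} := [set Some v; None].

Definition Estar : {set {set option V}} :=
  [set old_edge e | e in E] :|: [set new_edge v | v in nonterminals].

Definition orientation (tail head : {set option V} -> option V) : Prop :=
  forall e, e \in Estar -> e = [set tail e; head e].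

Definition incidence_mx (R : realFieldType) (tail head : {set option V} -> option V) :
    'M[R]_(#|{: option V}|, #|Estar|) :=
  \matrix_(i, j) ((enum_val i == tail (enum_val j))%:R
                  - (enum_val i == head (enum_val j))%:R).

(* The rows x_1, ..., x_k followed by those of the nonterminals. *)
Definition terminal_rows (R : realFieldType) (x : 'I_k -> V)
    (A : 'M[R]_(#|{: option V}|, #|Estar|)) :
    'M[R]_(k + #|nonterminals|, #|Estar|) :=
  rowsub (fun i : 'I_(k + #|nonterminals|) =>
            enum_rank (Some (match fintype.split i with
                             | inl i1 => x i1
                             | inr i2 => enum_val i2
                             end))) A.

End Terminals.
End Graphs.

(* Main.v *)
(* Let B be a set of edges of G^* with as many elements as A1 has rows. The columns
   of A1[B] are independent iff every connected component of (V^*, B) contains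
   exactly one vertex of T + v^*: a path of B between two such vertices gives a
   column dependency, the indicator vector of a component without such a vertex a
   row dependency; and likewise for A2 and S + v^*. In a common base, the component
   of each s_i therefore contains exactly one t_j, which yields a disjoint S-T path
   inside B. Since det A1[B] = +-1 and, for every component avoiding v^*, the rows
   sum to zero, the rows of A2[B] are those of A1[B] up to a block triangular matrix
   with diagonal blocks -sigma and 1, whence det A1[B] det A2[B] = (-1)^k sgn sigma.
   Conversely a disjoint S-T path P extends to the common base obtained by joining
   all nonterminals off P to v^*; it has the weight of P, and any other common base
   containing P has a larger weight, because it has more edges of positive length. *)
Require Import Defs.
From HB Require Import structures.
From mathcomp Require Import all_boot all_order all_algebra all_fingroup.
From mathcomp Require Import classical_sets functions reals boolp.
From mathcomp Require Import zify.

Set Implicit Arguments.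
Unset Strict Implicit.
Unset Printing Implicit Defensive.

Import Order.TTheory GRing.Theory Num.Theory.
Local Open Scope ring_scope.

Lemma eq_set2 (T : finType) (a b c d : T) :
  [set a; b] = [set c; d] -> (a = c /\ b = d) \/ (a = d /\ b = c).
Proof.
move=> eq_abcd; have /set2P[] : a \in [set c; d] by rewrite -eq_abcd set21.
- move=> ac; subst c; left; split=> //.
  have /set2P[da|//] : d \in [set a; b] by rewrite eq_abcd set22.
  by have /set2P[] : b \in [set a; d]; rewrite -?eq_abcd ?set22 // da.
- move=> ad; subst d; right; split=> //.
  have /set2P[ca|//] : c \in [set a; b] by rewrite eq_abcd set21.
  by have /set2P[] : b \in [set c; a]; rewrite -?eq_abcd ?set22 // ca.
Qed.

(** * Connectivity and nonsingular column sets of an incidence matrix *)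

Section IncidenceColumns.
Variables (R : archiRealFieldType) (W : finType) (n : nat).
Variables (tl hd : 'I_n -> W) (B : {set 'I_n}).

Definition inc (a : W) (j : 'I_n) : R := (a == tl j)%:R - (a == hd j)%:R.

(** Comparing unordered pairs forgets the orientation. *)
Definition adj : rel W :=
  [rel a b | [exists j in B, [set tl j; hd j] == [set a; b]]].

Lemma adj_connect_sym : connect_sym adj.
Proof. by apply: sym_connect_sym => a b; rewrite /adj /= finset.setUC. Qed.

(** Columns along a path, signed by the direction of travel, telescope. Integral coefficients are
    kept for the determinants later. *)
Lemma connect_comb (a b : W) : connect adj a b ->
  exists x : 'I_n -> R, (forall j, x j \is a Num.int) /\
    forall c, \sum_(j in B) inc c j * x j = (c == a)%:R - (c == b)%:R.
Proof.
move=> /connectP[p + ->] {b}; elim: p a => [|b p IHp] a /=.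
  move=> _; exists (fun=> 0); split=> // c.
  by rewrite subrr big1 // => j _; rewrite mulr0.
case/andP=> /exists_inP[j0 j0B /eqP ej0] /IHp[x [xint xE]].
have [y [yint yE]]: exists y : 'I_n -> R, (forall j, y j \is a Num.int) /\
    forall c, \sum_(j in B) inc c j * y j = (c == a)%:R - (c == b)%:R.
  (* Supported on [j0], with [z] = 1 or -1 for an edge traversed forwards or backwards. *)
  pose y (z : R) j := if j == j0 then z else 0.
  have sum_y z c : \sum_(j in B) inc c j * y z j = inc c j0 * z.
    rewrite (bigD1 j0) //= big1 ?addr0 /y ?eqxx // => j /andP[_ /negbTE->].
    by rewrite mulr0.
  case: (eq_set2 ej0) => [[tlE hdE]|[tlE hdE]].
  - exists (y 1); split=> [j|c]; first by rewrite /y; case: ifP; rewrite ?rpred1 ?rpred0.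
    by rewrite sum_y mulr1 /inc tlE hdE.
  - exists (y (-1)); split=> [j|c]; first by rewrite /y; case: ifP; rewrite ?rpredN ?rpred1 ?rpred0.
    by rewrite sum_y mulrN1 /inc tlE hdE opprB.
exists (fun j => y j + x j); split=> [j|c]; first by rewrite rpredD.
under eq_bigr do rewrite mulrDr.
by rewrite big_split /= yE xE addrA subrK.
Qed.

(** Both ends of an edge of [B] lie in one component, so its 1 and -1 count together or not at
    all. *)
Lemma sum_component (a : W) (j : 'I_n) : j \in B ->
  \sum_c (connect adj a c)%:R * inc c j = 0.
Proof.
move=> jB; have tlhd : connect adj (tl j) (hd j).
  by apply/connect1/exists_inP; exists j.
have pick1 d : \sum_c (connect adj a c)%:R * (c == d)%:R = (connect adj a d)%:R :> R.
  rewrite (bigD1 d) //= eqxx mulr1 big1 ?addr0 // => c /negbTE->.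
  by rewrite mulr0.
under eq_bigr do rewrite mulrBr.
rewrite sumrB !pick1 (same_connect_r adj_connect_sym tlhd a).
exact: subrr.
Qed.

Variables (r : nat) (rho : 'I_r -> W).
Hypothesis rho_inj : injective rho.

(** The vertices outside the image of [rho], whose rows are deleted, are the roots. *)
Definition inc_mx : 'M[R]_(r, n) := \matrix_(i, j) inc (rho i) j.

Lemma sum_col (hB : #|B| = r) (F : 'I_n -> R) :
  \sum_(j < r) F (enum_val (cast_ord (esym hB) j)) = \sum_(j in B) F j.
Proof.
rewrite [RHS]big_enum_val; case: r / hB => /=.
by apply: eq_bigr => j _; rewrite cast_ord_id.
Qed.

Lemma enum_col (hB : #|B| = r) j : j \in B ->
  exists j', enum_val (cast_ord (esym hB) j') = j.
Proof.
move=> jB; exists (cast_ord hB (enum_rank_in jB j)).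
by rewrite cast_ordK enum_rankK_in.
Qed.

(* A nonzero column combination vanishing on all rows shows that distinct roots
   lie in distinct components. *)
Lemma unit_root_sep (hB : #|B| = r) a b :
  col_submx inc_mx hB \in unitmx -> a \notin codom rho -> b \notin codom rho ->
  connect adj a b -> a = b.
Proof.
move=> uM aN bN /connect_comb[x [_ xE]].
pose v : 'cV[R]_r := \col_j x (enum_val (cast_ord (esym hB) j)).
have Mv0 : col_submx inc_mx hB *m v = 0.
  apply/colP => i; rewrite !mxE.
  under eq_bigr do rewrite !mxE.
  rewrite (sum_col hB (fun j => inc (rho i) j * x j)) xE.
  have neq c : c \notin codom rho -> (rho i == c) = false.
    by move=> cN; apply/eqP => eq_c; rewrite -eq_c codom_f in cN.
  by rewrite !neq // subrr.
have v0 : v = 0 by rewrite -(mulKmx uM v) Mv0 mulmx0.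
have x0 j : j \in B -> x j = 0.
  by case/(enum_col hB) => j' <-; move/colP/(_ j'): v0; rewrite !mxE.
(* The relation also holds at [a], which has no row, and reads 0 = 1 - (a == b) there. *)
have := xE a; rewrite big1 => [|j jB]; last by rewrite x0 // mulr0.
rewrite eqxx; case: eqP => // _ /eqP.
by rewrite subr0 eq_sym oner_eq0.
Qed.

Lemma sum_rho (F : W -> R) : (forall c, c \notin codom rho -> F c = 0) ->
  \sum_c F c = \sum_i F (rho i).
Proof.
move=> F0; rewrite (bigID [in codom rho]) /= [X in _ + X]big1 // addr0.
by rewrite -(big_imset _ (in2W rho_inj)); apply: eq_bigl => c;
  apply/codomP/imsetP => -[i]; exists i.
Qed.

(* The indicator vector of a component without roots is in the left kernel. *)
Lemma unit_reach_root (hB : #|B| = r) a :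
  col_submx inc_mx hB \in unitmx -> exists2 b, b \notin codom rho & connect adj a b.
Proof.
move=> uM; case: (pickP [pred b | (b \notin codom rho) && connect adj a b]).
  by move=> b /andP[]; exists b.
move=> no_root; pose u : 'rV[R]_r := \row_i (connect adj a (rho i))%:R.
have out c : c \notin codom rho -> (connect adj a c)%:R = 0 :> R.
  by move=> cN; have /= := no_root c; rewrite cN /= => ->.
have uM0 : u *m col_submx inc_mx hB = 0.
  apply/rowP => j; rewrite !mxE -[RHS](sum_component a (enum_valP (cast_ord (esym hB) j))).
  rewrite sum_rho => [|c cN]; last by rewrite out // mul0r.
  by apply: eq_bigr => i _; rewrite !mxE.
have u0 : u = 0 by rewrite -(mulmxK uM u) uM0 mul0mx.
have [/codomP[i aE]|aN] := boolP (a \in codom rho); last by exists a.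
by move/rowP/(_ i): u0; rewrite !mxE -aE connect0 => /eqP; rewrite oner_eq0.
Qed.

Hypothesis reach : forall i, exists2 b, b \notin codom rho & connect adj (rho i) b.

(** A path from [rho i'] to a root [b] yields the unit vector at [i'], as [b] has no row; together
    these form a right inverse, whatever the size of [B]. *)
Lemma reach_inverse : exists x : 'I_r -> 'I_n -> R,
  (forall i j, x i j \is a Num.int) /\
  forall i i', \sum_(j in B) inc (rho i) j * x i' j = (i == i')%:R.
Proof.
have /fin_all_exists2[x xint xE] : forall i', exists2 x : 'I_n -> R,
    forall j, x j \is a Num.int &
    forall i, \sum_(j in B) inc (rho i) j * x j = (i == i')%:R.
  move=> i'; have [b bN /connect_comb[x [xint xE]]] := reach i'.
  exists x => // i; rewrite xE (inj_eq rho_inj).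
  case: (rho i =P b) => [eq_b|_]; last by rewrite subr0.
  by rewrite -eq_b codom_f in bN.
by exists x.
Qed.

(** A right inverse needs at least as many columns as rows; this will bound the size of the base of
    a path from below. *)
Lemma reach_card : (r <= #|B|)%N.
Proof.
have [x [_ xE]] := reach_inverse.
pose M := \matrix_(i < r, j < #|B|) inc (rho i) (enum_val j).
pose X := \matrix_(j < #|B|, i < r) x i (enum_val j).
apply: (@mulmx1_min _ _ _ M X); apply/matrixP => i i'; rewrite !mxE -xE [RHS]big_enum_val.
by apply: eq_bigr => j _; rewrite !mxE.
Qed.

(* The inverse matrix is integral, so both determinants are integers. *)
Lemma reach_unit (hB : #|B| = r) :
  col_submx inc_mx hB \in unitmx /\ \det (col_submx inc_mx hB) ^+ 2 = 1.
Proof.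
have [x [xint xE]] := reach_inverse.
pose X := \matrix_(j < r, i < r) x i (enum_val (cast_ord (esym hB) j)).
have MX1 : col_submx inc_mx hB *m X = 1%:M.
  apply/matrixP => i i'; rewrite !mxE -xE.
  rewrite -(sum_col hB (fun j => inc (rho i) j * x i' j)).
  by apply: eq_bigr => j _; rewrite !mxE.
have [-> _] := mulmx1_unit MX1; split=> //.
have det_int (M : 'M[R]_r) : (forall i j, M i j \is a Num.int) -> \det M \is a Num.int.
  by move=> Mint; apply: rpred_sum => s _; rewrite rpredMsign; apply: rpred_prod.
have /intrP[m mE] : \det (col_submx inc_mx hB) \is a Num.int.
  by apply: det_int => i j; rewrite !mxE /inc rpredB ?rpred_nat.
have /intrP[m' m'E] : \det X \is a Num.int by apply: det_int => i j; rewrite !mxE.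
have := congr1 determinant MX1; rewrite det_mulmx det1 mE m'E -intrM => /eqP.
rewrite -[1](_ : 1%:~R = _) // eqr_int => /eqP mm'.
have m1 : `|m| = 1.
  apply/eqP; rewrite -abszE eqz_nat.
  by move/(congr1 absz)/eqP: mm'; rewrite abszM muln_eq1 => /andP[].
by rewrite -rmorphXn /= -real_normK ?num_real // m1 expr1n.
Qed.

End IncidenceColumns.

(** * Rows of the two matrices as vertices of [G^*] *)

Section Rows.
Variables (V : finType) (N : {set V}) (k : nat) (x : 'I_k -> V).

Definition row_vertex (i : 'I_(k + #|N|)) : option V :=
  Some (match fintype.split i with inl i1 => x i1 | inr i2 => enum_val i2 end).

Lemma row_vertex_lshift i : row_vertex (lshift _ i) = Some (x i).
Proof. by rewrite /row_vertex -[lshift _ i]/(unsplit (inl i)) unsplitK. Qed.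

Lemma row_vertex_rshift i : row_vertex (rshift _ i) = Some (enum_val i).
Proof. by rewrite /row_vertex -[rshift _ i]/(unsplit (inr i)) unsplitK. Qed.

Lemma codom_row_vertex c :
  (c \in codom row_vertex) = if c is Some v then (v \in codom x) || (v \in N) else false.
Proof.
case: c => [v|]; last by apply/codomP => -[].
apply/codomP/orP => [[i]|[/codomP[i ->]|vN]].
- case: (split_ordP i) => i' ->; rewrite ?row_vertex_lshift ?row_vertex_rshift => -[->].
    by left; apply: codom_f.
  by right; apply: enum_valP.
- by exists (lshift _ i); rewrite row_vertex_lshift.
- by exists (rshift _ (enum_rank_in vN v)); rewrite row_vertex_rshift enum_rankK_in.
Qed.

Lemma row_vertex_inj : injective x -> (forall i, x i \notin N) -> injective row_vertex.
Proof.
move=> x_inj xN i j; case: (split_ordP i) => i' ->; case: (split_ordP j) => j' ->;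
  rewrite ?row_vertex_lshift ?row_vertex_rshift => -[].
- by move/x_inj ->.
- by move=> xE; have := xN i'; rewrite xE enum_valP.
- by move=> xE; have := xN j'; rewrite -xE enum_valP.
- by move/enum_val_inj ->.
Qed.

End Rows.
Arguments row_vertex [V] N [k] x i.

(** * Edge sets of paths, and the two kinds of edges of [G^*] *)

Section PathEdges.
Variable V : finType.
Implicit Types (x : V) (p : seq V).

Lemma path_edges_cons x y p :
  path_edges x (y :: p) = [set x; y] |: path_edges y p.
Proof. by apply/setP => e; rewrite !inE. Qed.

Lemma path_edgesP (e : rel V) x p f : path e x p -> f \in path_edges x p ->
  exists u v, [/\ u \in x :: p, v \in x :: p, e u v & f = [set u; v]].
Proof.
elim: p x => [|y p IHp] x /=; first by rewrite inE.
case/andP=> exy ep; rewrite path_edges_cons => /setU1P[->|fp].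
  by exists x, y; rewrite !inE !eqxx orbT.
have [u [v [up vp euv ->]]] := IHp _ ep fp.
by exists u, v; rewrite !(in_cons x) up vp !orbT.
Qed.

Lemma path_in_path_edges x p :
  path (fun u v => [set u; v] \in path_edges x p) x p.
Proof.
elim: p x => //= y p IHp x; rewrite path_edges_cons setU11 /=.
by apply: sub_path (IHp y) => u v uv; apply: setU1r.
Qed.

(** A one-vertex path has no edges, hence the condition on [p]. *)
Lemma mem_cover_path_edges x p v :
  p != [::] -> v \in x :: p -> v \in finset.cover (path_edges x p).
Proof.
elim: p x => // y p IHp x _; rewrite path_edges_cons inE => /predU1P[->|vp].
  by apply/bigcupP; exists [set x; y]; rewrite ?setU11 ?set21.
have [p0|pN0] := eqVneq p [::].
  move: vp; rewrite p0 inE => /eqP->.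
  by apply/bigcupP; exists [set x; y]; rewrite ?setU11 ?set22.
have /bigcupP[e ep ve] := IHp _ pN0 vp.
by apply/bigcupP; exists e => //; apply: setU1r.
Qed.

Lemma card_path_edges x p : (#|path_edges x p| <= size p)%N.
Proof.
elim: p x => [|y p IHp] x; last first.
  by rewrite path_edges_cons cardsU1 -[size _]/(1 + size p)%N leq_add ?leq_b1.
by rewrite leqn0 cards_eq0; apply/eqP/setP => e; rewrite !inE.
Qed.

Lemma old_edge_inj : injective (@old_edge V).
Proof. by apply: imset_inj => u v []. Qed.

Lemma old_edge2 (u v : V) : old_edge [set u; v] = [set Some u; Some v].
Proof. by rewrite /old_edge imsetU !imset_set1. Qed.

Lemma old_edge_neq_new (e : {set V}) v : old_edge e != new_edge v.
Proof.
by apply/eqP => eqe; have /imsetP[] : None \in old_edge e by rewrite eqe set22.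
Qed.

Lemma new_edge_inj : injective (@new_edge V).
Proof. by move=> u v /eq_set2[[[]]|[]]. Qed.

End PathEdges.

Section CommonBases.
Variables (R : archiRealFieldType) (V : finType) (E : {set {set V}}).
Variables (k : nat) (s t : 'I_k -> V).
Hypotheses (s_inj : injective s) (t_inj : injective t) (st : forall i j, s i != t j).
Variables (tail head : {set option V} -> option V).
Hypothesis orient : orientation E s t tail head.

Local Notation N := (nonterminals s t).
Local Notation Es := (Estar E s t).
Local Notation tl := (fun j : 'I_#|Es| => tail (enum_val j)).
Local Notation hd := (fun j : 'I_#|Es| => head (enum_val j)).
Local Notation A1 := (terminal_rows s (incidence_mx E s t R tail head)).
Local Notation A2 := (terminal_rows t (incidence_mx E s t R tail head)).
Local Notation conn B := (connect (adj tl hd B)).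
Implicit Types (B : {set 'I_#|Es|}) (P : {set {set V}}).

Lemma terminal_rowsE (x : 'I_k -> V) :
  terminal_rows x (incidence_mx E s t R tail head) = inc_mx R tl hd (row_vertex N x).
Proof. by apply/matrixP => i j; rewrite !mxE enum_rankK. Qed.

Lemma nonterminalE v : (v \in N) = (v \notin codom s) && (v \notin codom t).
Proof. by rewrite inE mem_cat negb_or. Qed.

Lemma s_notin i : s i \notin N.
Proof. by rewrite nonterminalE codom_f. Qed.

Lemma t_notin i : t i \notin N.
Proof. by rewrite nonterminalE codom_f andbF. Qed.

Lemma s_notin_t i : s i \notin codom t.
Proof. by apply/codomP => -[j /eqP]; rewrite (negbTE (st _ _)). Qed.

Lemma t_notin_s i : t i \notin codom s.
Proof. by apply/codomP => -[j /esym/eqP]; rewrite (negbTE (st _ _)). Qed.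

Let rs_inj := row_vertex_inj s_inj s_notin.
Let rt_inj := row_vertex_inj t_inj t_notin.

Lemma root_s c :
  (c \notin codom (row_vertex N s)) = if c is Some v then v \in codom t else true.
Proof.
rewrite codom_row_vertex; case: c => // v; rewrite nonterminalE negb_or negb_and !negbK.
case: (boolP (v \in codom t)) => [/codomP[i ->]|_]; last by case: (v \in _).
by rewrite t_notin_s orbT.
Qed.

Lemma root_t c :
  (c \notin codom (row_vertex N t)) = if c is Some v then v \in codom s else true.
Proof.
rewrite codom_row_vertex; case: c => // v; rewrite nonterminalE negb_or negb_and !negbK.
case: (boolP (v \in codom s)) => [/codomP[i ->]|_]; last by case: (v \in _).
by rewrite s_notin_t.
Qed.

(** [orient] identifies each column with its pair of ends, which frees adjacency from the
    orientation. *)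
Lemma adjP B a b :
  reflect (exists2 j, j \in B & enum_val j = [set a; b]) (adj tl hd B a b).
Proof.
apply: (iffP exists_inP) => -[j jB eqj]; exists j => //.
  by rewrite (orient (enum_valP j)); apply/eqP.
by rewrite -(orient (enum_valP j)) eqj.
Qed.

(** * Linking permutation and determinants of a common base *)

Section Determinants.
Variables (B : {set 'I_#|Es|}) (hB : #|B| = (k + #|N|)%N).
Hypotheses (u1 : col_submx A1 hB \in unitmx) (u2 : col_submx A2 hB \in unitmx).

Lemma base_sep_t a b : a \notin codom (row_vertex N s) ->
  b \notin codom (row_vertex N s) -> conn B a b -> a = b.
Proof. by move: u1; rewrite terminal_rowsE; apply: unit_root_sep. Qed.

Lemma base_sep_s a b : a \notin codom (row_vertex N t) ->
  b \notin codom (row_vertex N t) -> conn B a b -> a = b.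
Proof. by move: u2; rewrite terminal_rowsE; apply: unit_root_sep. Qed.

(** Nonsingularity of [A1[B]] joins [s i] to T or [v^*]; that of [A2[B]] excludes [v^*] and keeps
    distinct sources apart, so the map is injective. *)
Lemma base_perm : exists sigma : 'S_k, forall i, conn B (Some (s i)) (Some (t (sigma i))).
Proof.
have /fin_all_exists[f fE] i : exists j, conn B (Some (s i)) (Some (t j)).
  have [[v|] vN sv] : exists2 b, b \notin codom (row_vertex N s) & conn B (Some (s i)) b.
  - by apply: (@unit_reach_root R _ _ _ _ _ _ _ rs_inj hB); rewrite -terminal_rowsE.
  - by move: vN sv; rewrite root_s => /codomP[j ->]; exists j.
  - by have := base_sep_s _ _ sv; rewrite !root_t codom_f => /(_ isT isT).
have f_inj : injective f.
  move=> i j eqf; apply: s_inj.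
  have : conn B (Some (s i)) (Some (s j)).
    by apply: connect_trans (fE i) _; rewrite eqf adj_connect_sym.
  by move/base_sep_s; rewrite !root_t !codom_f => /(_ isT isT)[].
by exists (perm f_inj) => i; rewrite permE.
Qed.

(* Summing the rows of the component of t_i expresses row t_i through the rows of
   A1: the transition matrix is block triangular with diagonal blocks -sigma and 1. *)
Lemma base_det (sigma : 'S_k) :
  (forall i, conn B (Some (s i)) (Some (t (sigma i)))) ->
  \det (col_submx A1 hB) * \det (col_submx A2 hB) = (-1) ^+ k * (-1) ^+ sigma.
Proof.
move=> st_conn.
pose T : 'M[R]_(k + #|N|) := block_mx (- perm_mx sigma^-1)
  (\matrix_(i, m) - (conn B (Some (t i)) (Some (enum_val m)))%:R) 0 1%:M.
(* A vertex [s i'] joined to [t i] leads on to [t (sigma i')], and a component holds at most one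
   vertex of T. *)
have connE i i' : conn B (Some (t i)) (Some (s i')) = ((sigma^-1)%g i == i').
  apply/idP/eqP => [ti|<-]; last by rewrite adj_connect_sym -{2}(permKV sigma i).
  have /base_sep_t := connect_trans ti (st_conn i').
  by rewrite !root_s !codom_f => /(_ isT isT)[] /t_inj ->; rewrite permK.
have A2E : col_submx A2 hB = T *m col_submx A1 hB.
  apply/matrixP => i j; rewrite !terminal_rowsE !mxE big_split_ord /=.
  set c := enum_val (cast_ord _ j).
  under eq_bigr do rewrite !mxE row_vertex_lshift.
  under [X in _ + X]eq_bigr do rewrite !mxE row_vertex_rshift.
  rewrite /T; case: (split_ordP i) => i' ->; rewrite ?row_vertex_lshift ?row_vertex_rshift; last first.
    under eq_bigr do rewrite row_mxEl mxE mul0r.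
    under [X in _ + X]eq_bigr do rewrite row_mxEr mxE.
    rewrite big1 // add0r (bigD1 i') //= eqxx mul1r big1 ?addr0 // => m.
    by rewrite eq_sym => /negbTE->; rewrite mul0r.
  under eq_bigr do rewrite row_mxEl !mxE -connE mulNr.
  under [X in _ + X]eq_bigr do rewrite row_mxEr !mxE mulNr.
  rewrite !sumrN -opprD; apply/eqP; rewrite -subr_eq0 opprK; apply/eqP.
  rewrite -[RHS](sum_component R tl hd (Some (t i')) (enum_valP (cast_ord (esym hB) j))) -/c.
  rewrite (bigD1 (Some (t i'))) //= connect0 mul1r; congr (_ + _).
  (* The term at [t i'] has been split off; zeroing it makes [F] vanish outside the rows of [A1],
     since the component contains no other root. *)
  pose F d := if d == Some (t i') then 0
              else (conn B (Some (t i')) d)%:R * inc R tl hd d c.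
  rewrite [RHS]big_mkcond [RHS](eq_bigr F) => [|d _]; last by rewrite /F if_neg.
  rewrite (sum_rho rs_inj) => [|d]; last first.
    rewrite /F => dN; case: eqP => // neq_d.
    case: (boolP (conn B _ d)) => [/base_sep_t|]; last by rewrite mul0r.
    by rewrite root_s codom_f => /(_ isT dN) eq_d; case: neq_d.
  rewrite big_split_ord /=; congr (_ + _); apply: eq_bigr => m _.
  - by rewrite row_vertex_lshift /F -[_ == _]/(s m == t i') (negbTE (st _ _)).
  - rewrite row_vertex_rshift /F -[_ == _]/(enum_val m == t i'); case: eqP => // mE.
    by have := enum_valP m; rewrite mE (negbTE (t_notin _)).
have reach i : exists2 b, b \notin codom (row_vertex N s) & conn B (row_vertex N s i) b.
  by apply: (@unit_reach_root R _ _ _ _ _ _ _ rs_inj hB); rewrite -terminal_rowsE.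
have detA1 : \det (col_submx A1 hB) ^+ 2 = 1.
  by rewrite terminal_rowsE; case: (reach_unit R rs_inj reach hB).
(* The product is [det T] times the square of [det A1[B]]; negating k rows gives [(-1) ^+ k], and
   [sigma^-1] has the parity of [sigma]. *)
rewrite A2E det_mulmx mulrCA -expr2 detA1 mulr1 det_ublock det1 mulr1.
by rewrite -scaleN1r detZ det_perm odd_permV.
Qed.

End Determinants.

(** * From a common base to a disjoint path *)

Definition old_part B := [set e in E | [exists j in B, enum_val j == old_edge e]].

Lemma Estar_enum e : e \in Es -> exists j : 'I_#|Es|, enum_val j = e.
Proof. by move=> eEs; exists (enum_rank_in eEs e); rewrite enum_rankK_in. Qed.

Lemma old_edge_in_Estar e : (old_edge e \in Es) = (e \in E).
Proof.
apply/setUP/idP => [[/imsetP[f fE /old_edge_inj->] //|/imsetP[v _ /eqP]]|eE].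
  by rewrite (negbTE (old_edge_neq_new _ _)).
by left; apply: imset_f.
Qed.

Lemma old_partP B e :
  reflect (exists2 j, j \in B & enum_val j = old_edge e) (e \in old_part B).
Proof.
apply: (iffP setIdP) => [[_ /exists_inP[j jB /eqP ej]]|[j jB ej]].
  by exists j.
split; last by apply/exists_inP; exists j; rewrite ?ej.
by rewrite -old_edge_in_Estar -ej enum_valP.
Qed.

Lemma adj_old B u v : adj tl hd B (Some u) (Some v) = ([set u; v] \in old_part B).
Proof. by apply/adjP/old_partP => -[j jB ej]; exists j; rewrite // ej old_edge2. Qed.

Lemma path_adj_old B a p :
  path (adj tl hd B) (Some a) (map Some p)
    = path (fun u v => [set u; v] \in old_part B) a p.
Proof. by rewrite path_map; apply: eq_path => u v; apply: adj_old. Qed.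

(** A path through [v^*] would join [a] to it, so only edges of G are used. The last clause serves
    to separate paths from different sources. *)
Lemma connect_path B a b : conn B (Some a) (Some b) -> ~~ conn B (Some a) None ->
  exists p, [/\ path (fun u v => [set u; v] \in old_part B) a p, last a p = b,
    uniq (a :: p) & forall v, v \in a :: p -> conn B (Some a) (Some v)].
Proof.
case/connectP => q0 /shortenP[q pq uq _] lq aN.
have cq := path_connect pq.
have Nq : None \notin q.
  by apply: contra aN => Nq; apply: cq; rewrite inE Nq orbT.
(* [pmap id] strips [Some] and drops nothing, since [None] does not occur. *)
have qE : q = map Some (pmap id q).
  rewrite pmapS_filter map_id; apply/esym/all_filterP/allP => -[] // Nq'.
  by rewrite Nq' in Nq.
rewrite qE in pq uq lq cq; exists (pmap id q); split.
- by rewrite -path_adj_old.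
- by rewrite last_map in lq; case: lq.
- by move: uq; rewrite -[Some a :: _]/(map Some (a :: _)) map_inj_uniq // => ? ? [].
- by move=> v vq; apply: cq; rewrite -[Some a :: _]/(map Some (a :: _)) map_f.
Qed.

(** Paths from distinct sources lie in distinct components, hence are disjoint. The clause on [None]
    will decide which edges at [v^*] a minimum base contains. *)
Lemma base_path B (hB : #|B| = (k + #|N|)%N) :
  col_submx A1 hB \in unitmx -> col_submx A2 hB \in unitmx ->
  exists P sigma, [/\ disjoint_path_perm E s t P sigma, P \subset old_part B,
    forall v, v \in finset.cover P -> ~~ conn B (Some v) None
  & \det (col_submx A1 hB) * \det (col_submx A2 hB) = (-1) ^+ k * (-1) ^+ sigma].
Proof.
move=> u1 u2; have [sigma st_conn] := base_perm u1 u2.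
have sN i : ~~ conn B (Some (s i)) None.
  by apply/negP => /(base_sep_s u2); rewrite !root_t codom_f => /(_ isT isT).
have /fin_all_exists[p pE] i := connect_path (st_conn i) (sN i).
exists (\bigcup_(i < k) path_edges (s i) (p i)), sigma; split; last exact: base_det.
- exists p; split=> // [i|i|i|i j neq_ij]; try by case: (pE i).
    have [pi _ _ _] := pE i; apply: sub_path pi => u v.
    by case/setIdP.
  rewrite disjoint_has; apply/hasPn => v vi; apply/negP => vj.
  have [_ _ _ /(_ v vi) ci] := pE i; have [_ _ _ /(_ v vj) cj] := pE j.
  rewrite adj_connect_sym in cj.
  move/(base_sep_s u2): (connect_trans ci cj).
  by rewrite !root_t !codom_f => /(_ isT isT)[] /s_inj/eqP; rewrite (negbTE neq_ij).
- apply/bigcupsP => i _; apply/fintype.subsetP => e; have [pi _ _ _] := pE i.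
  by case/(path_edgesP pi) => u [v [_ _ uv ->]].
- move=> v /bigcupP[e /bigcupP[i _ ei] ve].
  have [pi _ _ ci] := pE i; have [u1' [u2' [in1 in2 _ eE]]] := path_edgesP pi ei.
  have cv : conn B (Some (s i)) (Some v).
    by move: ve; rewrite eE => /set2P[]->; apply: ci.
  by apply: contra (sN i) => /(connect_trans cv).
Qed.

(** * From a disjoint path to a common base *)

Definition path_base P : {set 'I_#|Es|} :=
  [set j | [exists e in P, enum_val j == old_edge e]
        || [exists v in N :\: finset.cover P, enum_val j == new_edge v]].

Lemma path_base_old P e j :
  enum_val j = old_edge e -> (j \in path_base P) = (e \in P).
Proof.
move=> ej; rewrite inE ej; apply/orP/idP => [[]|eP]; last first.
- by left; apply/exists_inP; exists e.
- by case/exists_inP => v _; rewrite (negbTE (old_edge_neq_new _ _)).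
- by case/exists_inP => f fP /eqP/old_edge_inj->.
Qed.

Lemma path_base_new P v j :
  enum_val j = new_edge v -> (j \in path_base P) = (v \in N :\: finset.cover P).
Proof.
move=> ej; rewrite inE ej; apply/orP/idP => [[]|vN]; last first.
- by right; apply/exists_inP; exists v.
- by case/exists_inP => u uN /eqP/new_edge_inj->.
- by case/exists_inP => e _; rewrite eq_sym (negbTE (old_edge_neq_new _ _)).
Qed.

Lemma disjoint_path_sub P : disjoint_path E s t P -> P \subset E.
Proof.
case=> sigma [p [pE _ _ _ ->]]; apply/bigcupsP => i _; apply/fintype.subsetP => e.
by case/(path_edgesP (pE i)) => u [v [_ _ uv ->]].
Qed.

(** This left inverse makes [path_base] injective on disjoint paths. *)
Lemma old_part_path_base P : disjoint_path E s t P -> old_part (path_base P) = P.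
Proof.
move/disjoint_path_sub/fintype.subsetP => PE; apply/setP => e.
apply/old_partP/idP => [[j jB ej]|eP]; first by rewrite -(path_base_old P ej).
have [j ej] : exists j : 'I_#|Es|, enum_val j = old_edge e.
  by apply: Estar_enum; rewrite old_edge_in_Estar PE.
by exists j; rewrite ?(path_base_old P ej).
Qed.

Lemma card_nonterminals : (k + k + #|N| = #|V|)%N.
Proof.
have NE : N = ~: [set v in codom s ++ codom t] by apply/setP => v; rewrite !inE.
rewrite NE -(cardsC [set v in codom s ++ codom t]); congr (_ + _)%N.
rewrite cardsE (card_uniqP _) ?size_cat ?size_codom ?card_ord //.
rewrite cat_uniq; apply/and3P; split; try by apply/injectiveP.
by apply/hasPn => v /codomP[i ->]; apply: t_notin_s.
Qed.

(** With m the sum of the [size (p i)], the paths have at most m edges and exactly m + k vertices;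
    as V has 2k + #|N| elements, at most k + #|N| - m nonterminals lie off them. *)
Lemma card_path_base P : disjoint_path E s t P -> (#|path_base P| <= k + #|N|)%N.
Proof.
case=> sigma [p [pE plast puniq pdisj PE]].
pose VP := \bigcup_(i < k) [set v in s i :: p i].
have cardB : (#|path_base P| <= #|P| + #|N :\: finset.cover P|)%N.
  rewrite -(card_imset _ enum_val_inj) -(card_imset P (@old_edge_inj V)).
  rewrite -(card_imset (N :\: _) (@new_edge_inj V)).
  apply: leq_trans (leq_card_setU _ _); apply/subset_leq_card/fintype.subsetP.
  move=> _ /imsetP[j + ->]; rewrite inE => /orP[]/exists_inP[x xP /eqP->].
    by apply/setUP; left; apply: imset_f.
  by apply/setUP; right; apply: imset_f.
have cardP : (#|P| <= \sum_(i < k) size (p i))%N.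
  rewrite PE; elim/big_ind2: _ => [|A a A' a' leA leA'|i _]; first by rewrite cards0.
    by apply: leq_trans (leq_card_setU _ _) (leq_add leA leA').
  exact: card_path_edges.
have cardVP : #|VP| = (\sum_(i < k) size (p i) + k)%N.
  rewrite -sum1_card partition_disjoint_bigcup => [|i j neq_ij]; last first.
    rewrite disjoint_subset; apply/fintype.subsetP => v; rewrite finset.in_set => vi.
    by rewrite inE /= finset.in_set (disjointFr (pdisj _ _ neq_ij) vi).
  under eq_bigr do rewrite sum1_card cardsE (card_uniqP (puniq _)) /= -addn1.
  by rewrite big_split /= sum_nat_const card_ord muln1.
have NVP : N :\: finset.cover P \subset ~: VP.
  apply/fintype.subsetP => v /setDP[vN vP]; rewrite inE; apply: contra vP.
  case/bigcupP => i _; rewrite inE => vi.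
  (* An empty [p i] would give [s i = t (sigma i)]; so every path has an edge, and [cover P]
     contains its vertices. *)
  have pN0 : p i != [::].
    by apply: contra (st i (sigma i)) => /eqP p0; rewrite -(plast i) p0.
  have /bigcupP[e ei ve] := mem_cover_path_edges pN0 vi.
  by apply/bigcupP; exists e => //; rewrite PE; apply/bigcupP; exists i.
have := subset_leq_card NVP; have := cardsC VP; have := card_nonterminals.
move: cardB cardP cardVP; lia.
Qed.

(** A nonterminal off P is adjacent to [v^*]; any other vertex lies on a path, whose two ends are
    roots, one for each matrix. *)
Lemma path_base_connect P sigma : disjoint_path_perm E s t P sigma -> forall v,
  conn (path_base P) (Some v) None \/
  exists i, conn (path_base P) (Some v) (Some (s i)) /\
            conn (path_base P) (Some v) (Some (t (sigma i))).
Proof.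
move=> dP; have disP : disjoint_path E s t P by exists sigma.
have [p [pE plast puniq pdisj PE]] := dP; move=> v.
have onp i x : x \in s i :: p i -> conn (path_base P) (Some (s i)) (Some x).
  move=> xi; apply: (@path_connect _ _ _ (map Some (p i))).
    rewrite path_adj_old old_part_path_base //.
    apply: sub_path (path_in_path_edges (s i) (p i)) => a b ab.
    by rewrite PE; apply/bigcupP; exists i.
  by rewrite -[Some (s i) :: _]/(map Some (s i :: _)) map_f.
have onP i x : x \in s i :: p i -> exists i,
    conn (path_base P) (Some x) (Some (s i)) /\
    conn (path_base P) (Some x) (Some (t (sigma i))).
  move=> /onp sx; exists i; rewrite adj_connect_sym in sx; split=> //.
  by apply: connect_trans sx _; apply: onp; rewrite -plast mem_last.
have [vN|] := boolP (v \in N); last first.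
  rewrite nonterminalE negb_and !negbK => /orP[]/codomP[i ->]; right.
    by apply: (onP i); rewrite mem_head.
  by apply: (onP ((sigma^-1)%g i)); rewrite -{1}(permKV sigma i) -plast mem_last.
have [/bigcupP[e] |vP] := boolP (v \in finset.cover P).
  rewrite {1}PE => /bigcupP[i _ ei].
  have [a [b [ai bi _ ->]]] := path_edgesP (pE i) ei.
  by case/set2P => ->; right; apply: (onP i).
left; have [j ej] : exists j : 'I_#|Es|, enum_val j = new_edge v.
  by apply/Estar_enum/setUP; right; apply: imset_f.
by apply/connect1/adjP; exists j; rewrite // (path_base_new P ej) inE vP.
Qed.

Lemma path_base_common P : disjoint_path E s t P -> common_base A1 A2 (path_base P).
Proof.
move=> disP; have [sigma dP] := disP; have cP := path_base_connect dP.
have reach_s i : exists2 b, b \notin codom (row_vertex N s) &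
    conn (path_base P) (row_vertex N s i) b.
  rewrite /row_vertex; set v := (X in Some X).
  have [vN|[i' [_ vt]]] := cP v; first by exists None; rewrite ?root_s.
  by exists (Some (t (sigma i'))); rewrite ?root_s ?codom_f.
have reach_t i : exists2 b, b \notin codom (row_vertex N t) &
    conn (path_base P) (row_vertex N t i) b.
  rewrite /row_vertex; set v := (X in Some X).
  have [vN|[i' [vs _]]] := cP v; first by exists None; rewrite ?root_t.
  by exists (Some (s i')); rewrite ?root_t ?codom_f.
have hB : #|path_base P| = (k + #|N|)%N.
  by apply/eqP; rewrite eqn_leq card_path_base //= (reach_card R rs_inj reach_s).
exists hB; rewrite !terminal_rowsE.
by have [? _] := reach_unit R rs_inj reach_s hB; have [? _] := reach_unit R rt_inj reach_t hB.
Qed.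

(** * Weights of bases and lengths of paths *)

Section Weights.
Variables (l : {set V} -> R) (w : {set option V} -> R).
Hypothesis l_gt0 : forall e, e \in E -> 0 < l e.
Hypothesis w_old : forall e, e \in E -> w (old_edge e) = l e.
Hypothesis w_new : forall v, v \in N -> w (new_edge v) = 0.

(** Edges at [v^*] weigh nothing. *)
Lemma weight_old_part B : \sum_(j in B) w (enum_val j) = \sum_(e in old_part B) l e.
Proof.
rewrite -(big_imset w (in2W enum_val_inj)) /=.
rewrite (eq_bigr (w \o @old_edge V)) => [|e /setIdP[eE _]]; last by rewrite /= w_old.
rewrite -(big_imset w (in2W (@old_edge_inj V))) /=.
rewrite [LHS](big_setID [set old_edge e | e in old_part B]) /=.
rewrite [X in _ + X]big1 ?addr0 => [|x].
  apply: eq_bigl => x; rewrite inE andbC; case: imsetP => //= -[e /old_partP[j jB <-] ->].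
  exact: imset_f.
case/setDP => /imsetP[j jB ->] xN; have /setUP[/imsetP[e eE ej]|/imsetP[v vN ->]] := enum_valP j.
  by rewrite ej imset_f // in xN; apply/old_partP; exists j.
exact: w_new.
Qed.

(** An edge of [old_part B] outside P has positive length, so equal weights force equal sets. *)
Lemma base_path_weight B P : P \subset old_part B ->
  \sum_(e in P) l e <= \sum_(j in B) w (enum_val j) ?= iff (P == old_part B).
Proof.
move=> PB; rewrite weight_old_part [\sum_(e in old_part B) _](big_setID P) /= (finset.setIidPr PB).
have l_ge0 e : e \in old_part B :\: P -> 0 <= l e.
  by case/setDP => /setIdP[eE _] _; apply/ltW/l_gt0.
apply/leifP; case: eqP => [<-|/eqP neqP].
  by rewrite finset.setDv big_set0 addr0.
have /set0Pn[e eD] : old_part B :\: P != finset.set0.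
  by rewrite finset.setD_eq0; apply: contra neqP => BP; rewrite finset.eqEsubset PB.
rewrite ltrDl (bigD1 e) //= ltr_wpDr ?sumr_ge0 // => [f /andP[fD _]|]; first exact: l_ge0.
by case/setDP: eD => /setIdP[eE _] _; apply: l_gt0.
Qed.

Lemma path_base_weight P : disjoint_path E s t P ->
  \sum_(j in path_base P) w (enum_val j) = \sum_(e in P) l e.
Proof. by move=> dP; rewrite weight_old_part old_part_path_base. Qed.

(** Every common base contains a disjoint path whose length is at most the weight of the base. *)
Lemma path_base_min P : shortest_disjoint_path E s t l P ->
  min_common_base A1 A2 (fun j => w (enum_val j)) (path_base P).
Proof.
case=> dP minP; split=> [|B [hB [u1 u2]]]; first exact: path_base_common.
have [Q [sigma [dQ QB _ _]]] := base_path u1 u2.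
rewrite path_base_weight //; apply: le_trans (minP Q _) _; first by exists sigma.
exact: base_path_weight.
Qed.

(** For the path P inside [B], minimality gives [w(B) <= w(path_base P) = l(P) <= w(B)], so [B] has
    no further edges of G. *)
Lemma min_base_path B : min_common_base A1 A2 (fun j => w (enum_val j)) B ->
  exists2 P, shortest_disjoint_path E s t l P & path_base P = B.
Proof.
case=> -[hB [u1 u2]] minB; have [P [sigma [dP PB PN _]]] := base_path u1 u2.
have disP : disjoint_path E s t P by exists sigma.
have baseP := path_base_common disP.
have leBP : \sum_(j in B) w (enum_val j) <= \sum_(e in P) l e.
  by rewrite -path_base_weight //; apply: minB.
exists P.
  split=> // Q dQ; apply: le_trans (base_path_weight PB) _.
  by rewrite -(path_base_weight dQ); apply: minB; apply: path_base_common.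
have /eqP PE : P == old_part B.
  by rewrite -(ge_leif (base_path_weight PB)).
have [hP _] := baseP; apply/esym/eqP; rewrite eqEcard hP hB leqnn andbT.
apply/fintype.subsetP => j jB; have /setUP[/imsetP[e eE ej]|/imsetP[v vN ej]] := enum_valP j.
  by rewrite (path_base_old P ej) PE; apply/old_partP; exists j.
(* If P covered [v], this edge of [B] would join a vertex of P to [v^*]. *)
rewrite (path_base_new P ej) inE vN andbT; apply/negP => /PN/negP; apply.
by apply/connect1/adjP; exists j.
Qed.

End Weights.

End CommonBases.

Theorem theorem4p8 (R : realType) (V : finType) (E : {set {set V}})
    (hE : is_graph E) (k : nat) (s t : 'I_k -> V)
    (hs : injective s) (ht : injective t) (hst : forall i j, s i != t j)
    (tail head : {set option V} -> option V)
    (hor : orientation E s t tail head)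
    (hLGV : LGV_position E s t) :
  let A := incidence_mx E s t R tail head in
  let A1 := terminal_rows s A in
  let A2 := terminal_rows t A in
  (Pfaffian_pair A1 A2 /\
   forall (P : {set {set V}}) (sigma : 'S_k),
     disjoint_path_perm E s t P sigma ->
     Pfaffian_with A1 A2 ((-1) ^+ k * (-1) ^+ sigma)) /\
  (forall (l : {set V} -> R) (w : {set option V} -> R),
     (forall e, e \in E -> 0 < l e) ->
     (forall e, e \in E -> w (old_edge e) = l e) ->
     (forall v, v \in nonterminals s t -> w (new_edge v) = 0) ->
     exists f : {set {set V}} -> {set 'I_#|Estar E s t|},
       set_bij [set P | shortest_disjoint_path E s t l P]%classic
               [set B | min_common_base A1 A2 (fun j => w (enum_val j)) B]%classic
               f).
Proof.
move=> A A1 A2.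
have pfaffian P (sigma : 'S_k) : disjoint_path_perm E s t P sigma ->
    Pfaffian_with A1 A2 ((-1) ^+ k * (-1) ^+ sigma).
  move=> dP; split; first by rewrite mulf_neq0 // signr_eq0.
  (* The product for [B] carries the sign of a path inside [B]; the LGV position makes it that of
     P. *)
  move=> B hB u1 u2; have [Q [tau [dQ _ _ ->]]] := base_path hs ht hst hor u1 u2.
  have /(congr1 (intr : int -> R)) := hLGV _ _ _ _ dQ dP.
  by rewrite !rmorph_sign => ->.
split.
  split=> //; have [[P [sigma dP]]|noP] := boolp.EM (exists P, disjoint_path E s t P).
    by exists ((-1) ^+ k * (-1) ^+ sigma); apply: pfaffian dP.
  (* Without disjoint paths there is no common base, so any nonzero constant serves. *)
  exists 1; split=> [|B hB u1 u2]; first exact: oner_neq0.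
  have [P [sigma [dP _ _ _]]] := base_path hs ht hst hor u1 u2.
  by case: noP; exists P, sigma.
move=> l w l_gt0 w_old w_new; exists (@path_base V E k s t); split.
- by move=> P minP; apply: (path_base_min hs ht hst hor l_gt0 w_old w_new minP).
- move=> P Q; rewrite !inE => -[dP _] [dQ _] eqPQ.
  by rewrite -(old_part_path_base dP) eqPQ old_part_path_base.
- move=> B /(min_base_path hs ht hst hor l_gt0 w_old w_new)[P minP PB].
  by exists P.
Qed.
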